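(* Let $\mu$ be a measure on the bi-tree $T^2$ with $0<|\mu|\le \mathcal{E}[\mu]<\infty$. Let $\delta>0$ and $\tau>0$. Then there exists $C_\tau<\infty$ such that $$\mathcal{E}_{\delta}[\mu]\le C_\tau\,\delta^{1-\tau}\,|\mu|^{1-\tau}\,\mathcal{E}[\mu]^{\tau}.$$
   Context: $T$ is a finite (but unboundedly large) simple dyadic tree: its nodes are the dyadic subintervals of $[0,1]$ of length $2^{-k}$, $0\le k\le N$, with $N$ arbitrary, partially ordered by inclusion ($a'\ge a$ means that $a'\supseteq a$, i.e. $a'$ is an ancestor of $a$ or equals $a$). The bi-tree is $T^2=T\times T$ with the product partial order: $(\alpha_1',\alpha_2')\ge(\alpha_1,\alpha_2)$ iff $\alpha_1'\ge\alpha_1$ and $\alpha_2'\ge\alpha_2$. For $f:T^2\to\mathbb{R}$ put $$\mathbb{I}f(\alpha)=\sum_{\alpha'\ge\alpha}f(\alpha'),\qquad \mathbb{I}^*f(\alpha)=\sum_{\alpha'\le\alpha}f(\alpha').$$ A measure on $T^2$ is a non-negative function $\mu$ on $T^2$, and $|\mu|=\sum_{\alpha\in T^2}\mu(\alpha)$ is its total mass. Its potential is $\mathbb{V}^\mu=\mathbb{I}(\mathbb{I}^*\mu)$. For $s>0$ let $E_s=\{\alpha\in T^2:\mathbb{V}^\mu(\alpha)\le s\}$. The truncated potential is $\mathbb{V}^\mu_\delta=\mathbb{I}(\mathbf{1}_{E_\delta}\mathbb{I}^*\mu)$. The energy and truncated energy are $$\mathcal{E}[\mu]=\sum_{\alpha\in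 T^2}\mathbb{V}^\mu(\alpha)\mu(\alpha)=\sum_{\alpha\in T^2}(\mathbb{I}^*\mu(\alpha))^2,\qquad \mathcal{E}_\delta[\mu]=\sum_{\alpha\in T^2}\mathbb{V}^\mu_\delta(\alpha)\mu(\alpha)=\sum_{\alpha\in E_\delta}(\mathbb{I}^*\mu(\alpha))^2.$$ The subscript in $C_\tau$ indicates that the constant depends only on $\tau$.
   Formalization: For τ>1 the bound is claimed only when δ|μ| ≤ E[μ] (automatic if δ ≤ 1); without this it is false for τ>1: a unit mass at the root has |μ|=E[μ]=E_δ[μ]=1 for all δ≥1, while δ^{1-τ}→0. For 0<τ≤1 nothing is changed. *)

(* Defs.v *)
From HB Require Import structures.
From mathcomp Require Import all_boot all_order all_algebra.
From mathcomp Require Import all_classical all_reals all_analysis.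

Set Implicit Arguments.
Unset Strict Implicit.
Unset Printing Implicit Defensive.

Import Order.TTheory GRing.Theory Num.Theory.
Local Open Scope ring_scope.

(* The pair (k, j) stands for the interval [j / 2 ^ k, (j + 1) / 2 ^ k]. *)
Definition dyadic (N : nat) : finType := {k : 'I_N.+1 & 'I_(2 ^ k)}.

Definition dyadic_itv (N : nat) (a : dyadic N) : interval rat :=
  let k : nat := tag a in
  let j : nat := tagged a in
  `[j%:R / 2 ^+ k, j.+1%:R / 2 ^+ k].

(* [<=] on [interval rat] is inclusion of intervals. *)
Definition dyadic_le (N : nat) (a b : dyadic N) : bool :=
  (dyadic_itv a <= dyadic_itv b)%O.

Definition bitree (N : nat) : finType := (dyadic N * dyadic N)%type.

Definition bitree_le (N : nat) (a b : bitree N) : bool :=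
  dyadic_le a.1 b.1 && dyadic_le a.2 b.2.

Section Potential.
Context {R : realType} {N : nat}.
Implicit Types (f mu : bitree N -> R) (a b : bitree N) (s delta : R).

Definition hardy f a : R := \sum_(b | bitree_le a b) f b.

Definition hardy_adj f a : R := \sum_(b | bitree_le b a) f b.

Definition is_measure mu : Prop := forall a, 0 <= mu a.

Definition mass mu : R := \sum_a mu a.

Definition potential mu : bitree N -> R := hardy (hardy_adj mu).

Definition sublevel mu s : {set bitree N} := [set a | potential mu a <= s]%SET.

Definition tpotential mu delta : bitree N -> R :=
  hardy (fun a => (a \in sublevel mu delta)%:R * hardy_adj mu a).

Definition energy mu : R := \sum_a potential mu a * mu a.

Definition tenergy mu delta : R := \sum_a tpotential mu delta a * mu a.

Lemma hardy_adjoint f mu :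
  \sum_a hardy f a * mu a = \sum_a f a * hardy_adj mu a.
Proof.
rewrite /hardy /hardy_adj.
under eq_bigr do rewrite big_distrl /=.
under [RHS]eq_bigr do rewrite big_distrr /=.
by rewrite (exchange_big_dep xpredT).
Qed.

Lemma energyE mu : energy mu = \sum_a hardy_adj mu a ^+ 2.
Proof.
by rewrite /energy hardy_adjoint; apply: eq_bigr => a _; rewrite expr2.
Qed.

Lemma tenergyE mu delta :
  tenergy mu delta = \sum_(a in sublevel mu delta) hardy_adj mu a ^+ 2.
Proof.
rewrite /tenergy hardy_adjoint [RHS]big_mkcond; apply: eq_bigr => a _.
by case: ifP; rewrite ?mul1r ?mul0r ?expr2.
Qed.

End Potential.

(* Main.v *)
(* Write [f = 1_{E_delta} I* mu], [g = I* mu], [V = I f], and let [I_1], [I_2]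
   be the one-variable Hardy operators.  Three facts drive the argument.
   - Since [f] is superadditive in the first variable and [V <= delta] on its
     support, [I_1^* (f . I_2 f) <= delta f].
   - Splitting pairs of points above a given one into comparable and
     incomparable pairs, [V^2 <= 2 delta V + 2 I (I_1 f . I_2 f)], so where [V]
     is at least a large multiple of [delta] it is controlled by
     [I (I_1 f . I_2 f)].
   - With [U = I_1 (f . I_1 f) >= (I_1 f)^2 / 2], the sums
     [Z t = \sum_{V > t} U (I_2 f)^2] satisfy [Z (t + s) <= (2 delta / s) Z t]
     for [t >= delta], because [V] must grow by [s] along a chain on which [U]
     is constant.  So [Z] decays faster than any power of [t / delta].
   Testing against [mu], the part of [\sum I_1 f . I_2 f . g] with [V <= t] is
   absorbed, and the part with [V > t] is handled by Cauchy-Schwarz, giving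
   [E_delta <= 32 (1 + n r) delta |mu| + 4 (2 / r)^n E] for all [n] and [r > 0].
   Taking [r = 2 A^{1/(n+1)}] with [A = E / (delta |mu|)] bounds [E_delta] by a
   multiple of [delta |mu| A^{1/(n+1)}]. *)
Require Import Defs.
From HB Require Import structures.
From mathcomp Require Import all_boot all_order all_algebra.
From mathcomp Require Import all_classical all_reals all_analysis.
From mathcomp Require Import ring lra.

Import Order.TTheory GRing.Theory Num.Theory.
Local Open Scope ring_scope.

(** * Sums along an order whose up-sets are chains *)

Section UpSum.
Context {R : realDomainType} {T : finType} (le : rel T).
Hypothesis rel_refl : reflexive le.
Hypothesis rel_trans : transitive le.
Hypothesis rel_chain : forall z x y, le z x -> le z y -> le x y || le y x.

Definition upsum (w : T -> R) x : R := \sum_(y | le x y) w y.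
Definition downsum (w : T -> R) x : R := \sum_(y | le y x) w y.

Lemma upsum_ge0 w x : (forall y, 0 <= w y) -> 0 <= upsum w x.
Proof. by move=> w0; apply: sumr_ge0. Qed.

Lemma ler_upsum w x y : (forall y, 0 <= w y) -> le x y -> upsum w y <= upsum w x.
Proof.
move=> w0 xy; rewrite /upsum [leRHS](bigID (le y)) /=.
rewrite [X in _ <= X + _](eq_bigl (le y)); first by rewrite lerDl sumr_ge0.
by move=> z; rewrite andbC; case: (boolP (le y z)) => //= /(rel_trans _ _ _ xy) ->.
Qed.

(** The points of [E] above [z] form a chain, so all of them lie above the lowest one, [x0], and
    their sum is at most [upsum w x0]. *)
Lemma upsum_on_le (E : pred T) w (t : R) z :
  (forall x, 0 <= w x) -> 0 <= t -> (forall x, E x -> upsum w x <= t) ->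
  \sum_(x | le z x) (E x)%:R * w x <= t.
Proof.
move=> w0 t0 Et.
case: (pickP [pred x | le z x && E x]) => [x1 Px1|noE]; last first.
  by rewrite big1 // => x zx; move: (noE x); rewrite /= zx /= => ->; rewrite mul0r.
pose P : pred T := [pred x | le z x && E x].
(* The lowest point is the one with the most points above it. *)
case: (@arg_maxnP T x1 P (fun x => #|le x|) Px1) => x0 /andP[zx0 Ex0] x0max.
have x0min x : le z x -> E x -> le x0 x.
  move=> zx Ex; have /orP[//|xx0] := rel_chain _ _ _ zx0 zx.
  have sub : le x0 \subset le x.
    by apply/fintype.subsetP => y; rewrite !unfold_in => /(rel_trans _ _ _ xx0).
  have := x0max x; rewrite /P /= zx Ex => /(_ isT) card_le.
  have /fintype.subset_cardP : #|le x0| = #|le x|.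
    by apply/eqP; rewrite eqn_leq card_le subset_leq_card.
  by move=> /(_ sub) /(_ x); rewrite !unfold_in rel_refl.
apply: le_trans (Et _ Ex0).
rewrite /upsum big_mkcond [leRHS]big_mkcond /=; apply: ler_sum => x _.
case: ifP => zx; last by case: ifP.
case: (boolP (E x)) => Ex; last by rewrite mul0r; case: ifP.
by rewrite x0min // mul1r.
Qed.

(** Two points [y], [z] above [x] are comparable, so each product [A y * B z] occurs in at least one
    sum on the right. *)
Lemma upsumM_le A B x : (forall y, 0 <= A y) -> (forall y, 0 <= B y) ->
  upsum A x * upsum B x <=
  upsum (fun y => A y * upsum B y) x + upsum (fun y => B y * upsum A y) x.
Proof.
move=> A0 B0.
have -> : upsum (fun y => B y * upsum A y) x =
    \sum_(y | le x y) \sum_(z | le x z && le z y) A y * B z.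
  rewrite /upsum; under eq_bigr do rewrite big_distrr /=.
  rewrite (exchange_big_dep (le x)) /=; last first.
    by move=> y z xy; apply: rel_trans.
  apply: eq_bigr => y xy; rewrite [RHS]big_mkcond [LHS]big_mkcond /=.
  by apply: eq_bigr => z _; rewrite mulrC.
rewrite /upsum big_distrl -big_split /=; apply: ler_sum => y xy.
rewrite !big_distrr /= [leLHS]big_mkcond [X in _ <= X + _]big_mkcond.
rewrite [X in _ <= _ + X]big_mkcond -big_split /=; apply: ler_sum => z _.
have AB : 0 <= A y * B z by rewrite mulr_ge0.
case: ifP => xz /=; last by rewrite addr0; case: ifP.
by have /orP[->|->] := rel_chain _ _ _ xy xz; [rewrite lerDl|rewrite lerDr]; case: ifP.
Qed.

Lemma upsum_sqr_le w x : (forall y, 0 <= w y) ->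
  upsum w x ^+ 2 <= 2 * upsum (fun y => w y * upsum w y) x.
Proof. by move=> w0; rewrite expr2 mulr_natl mulr2n upsumM_le. Qed.

(* Exchanging the sums, each [z <= p] contributes [m z] times the sum of [w]
   over the part of a chain where [upsum w <= t]. *)
Lemma downsum_mul_le (E : pred T) w m (t : R) p :
  (forall x, 0 <= w x) -> (forall x, 0 <= m x) -> 0 <= t ->
  (forall x y, le x y -> E x -> E y) -> (forall x, E x -> upsum w x <= t) ->
  downsum (fun x => (E x)%:R * w x * downsum m x) p <=
  t * ((E p)%:R * downsum m p).
Proof.
move=> w0 m0 t0 Eup Et.
case: (boolP (E p)) => Ep; last first.
  rewrite mul0r mulr0 /downsum big1 // => x xp.
  by rewrite (negbTE (contra (Eup _ _ xp) Ep)) !mul0r.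
rewrite mul1r /downsum; under eq_bigr do rewrite big_distrr /=.
rewrite (exchange_big_dep (fun z => le z p)) /=; last first.
  by move=> x z xp zx; apply: rel_trans xp.
rewrite big_distrr /=; apply: ler_sum => z zp.
rewrite -big_distrl /= ler_wpM2r //.
apply: le_trans (upsum_on_le E w t z w0 t0 Et).
rewrite big_mkcond [leRHS]big_mkcond; apply: ler_sum => x _.
have : 0 <= (E x)%:R * w x by rewrite mulr_ge0 // ler0n.
by case: (le x p); case: (le z x).
Qed.

(** As [u] vanishes where [upsum w] exceeds [t], [upsum u] is constant on that part of the chain
    above [x]. The rest of the chain carries at most [t] of [upsum w x], which leaves more than
    [s]. *)
Lemma upsum_level_le u w (t s : R) x :
  (forall y, 0 <= u y) -> (forall y, 0 <= w y) -> 0 <= t ->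
  (forall y, u y != 0 -> upsum w y <= t) -> t + s < upsum w x ->
  s * upsum u x <= upsum (fun y => (t < upsum w y)%R%:R * (w y * upsum u y)) x.
Proof.
move=> u0 w0 t0 ut tsx.
have -> : upsum (fun y => (t < upsum w y)%R%:R * (w y * upsum u y)) x =
    (\sum_(y | le x y) (t < upsum w y)%R%:R * w y) * upsum u x.
  rewrite big_distrl; apply: eq_bigr => y xy /=; rewrite -mulrA.
  case: (ltP t) => ty; last by rewrite !mul0r.
  (* A point [a] above [x] but not above [y] lies below [y], so [upsum w a > t] and [u a = 0]. *)
  congr (_ * (_ * _)); rewrite /upsum big_mkcond [RHS]big_mkcond.
  apply: eq_bigr => a _; case: (boolP (le y a)) => ya.
    by rewrite (rel_trans _ _ _ xy ya).
  case: ifP => // xa; have := rel_chain _ _ _ xy xa; rewrite (negbTE ya) /= => ay.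
  case: (eqVneq (u a) 0) => [->//|/ut ta].
  by have := lt_le_trans ty (le_trans (ler_upsum w a y w0 ay) ta); rewrite ltxx.
rewrite ler_wpM2r ?upsum_ge0 //.
have /= := upsum_on_le [pred y | upsum w y <= t] w t x w0 t0 (fun _ => id).
have wE : upsum w x = \sum_(y | le x y) (upsum w y <= t)%R%:R * w y +
    \sum_(y | le x y) (t < upsum w y)%R%:R * w y.
  rewrite -big_split; apply: eq_bigr => y _ /=.
  by case: (leP (upsum w y) t); rewrite ?mul1r ?mul0r ?addr0 ?add0r.
by rewrite wE in tsx; move: tsx => /[swap]; lra.
Qed.

End UpSum.

(** * Dyadic intervals under inclusion form a tree *)

Lemma dyadic_le_refl N : reflexive (@dyadic_le N).
Proof. by move=> a; apply: lexx. Qed.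

Lemma dyadic_le_trans N : transitive (@dyadic_le N).
Proof. by move=> b a c; apply: le_trans. Qed.

Lemma dyadic_leE N (a b : dyadic N) :
  dyadic_le a b =
  ((tagged b : nat)%:R / 2 ^+ tag b <= (tagged a : nat)%:R / 2 ^+ tag a :> rat) &&
  ((tagged a).+1%:R / 2 ^+ tag a <= (tagged b).+1%:R / 2 ^+ tag b :> rat).
Proof. by rewrite /dyadic_le /dyadic_itv subitvE !leBSide /=. Qed.

Lemma dyadic_le_of_tag N (a b c : dyadic N) :
  dyadic_le a b -> dyadic_le a c -> (tag c <= tag b)%N -> dyadic_le b c.
Proof.
have pow_gt0 m : 0 < (2 : rat) ^+ m by rewrite exprn_gt0.
(* Since [a] has positive length, [b] and [c] overlap in more than an endpoint. Over the common
   denominator the strict endpoint inequalities concern integers, so [m < n.+1] becomes the required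
   [m <= n]. *)
rewrite !dyadic_leE => /andP[ba ab] /andP[ca ac] cb.
have aa : (tagged a : nat)%:R / 2 ^+ tag a < (tagged a).+1%:R / 2 ^+ tag a :> rat.
  by rewrite ltr_pM2r ?invr_gt0 // ltr_nat.
have := le_lt_trans ba (lt_le_trans aa ac); have := le_lt_trans ca (lt_le_trans aa ab).
have -> : (2 : rat) ^+ tag b = 2 ^+ (tag b - tag c) * 2 ^+ tag c.
  by rewrite -exprD subnK.
have scale (m n k l : nat) :
  (m%:R / 2 ^+ k < n%:R / (2 ^+ l * 2 ^+ k) :> rat) = (m * 2 ^ l < n)%N.
  rewrite invfM mulrA ltr_pM2r ?invr_gt0 // ltr_pdivlMr // -natrX -natrM ltr_nat //.
have scale' (m n k l : nat) :
  (n%:R / (2 ^+ l * 2 ^+ k) < m%:R / 2 ^+ k :> rat) = (n < m * 2 ^ l)%N.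
  rewrite invfM mulrA ltr_pM2r ?invr_gt0 // ltr_pdivrMr // -natrX -natrM ltr_nat //.
rewrite scale scale' => lt1 lt2.
by apply/andP; split; rewrite leNgt ?scale ?scale' -leqNgt.
Qed.

Lemma dyadic_le_chain N (a b c : dyadic N) :
  dyadic_le a b -> dyadic_le a c -> dyadic_le b c || dyadic_le c b.
Proof.
move=> ab ac; case: (leqP (tag c) (tag b)) => [cb|/ltnW bc]; apply/orP; [left|right].
  exact: dyadic_le_of_tag ab ac cb.
exact: dyadic_le_of_tag ac ab bc.
Qed.

(** * One-variable Hardy operators on the bi-tree *)

Section Coordinates.
Context {R : realDomainType} {N : nat}.
Implicit Types f g h : bitree N -> R.

Let le := @dyadic_le N.

Definition up1 f (a : bitree N) : R := upsum le (fun x => f (x, a.2)) a.1.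
Definition up2 f (a : bitree N) : R := upsum le (fun y => f (a.1, y)) a.2.
Definition down1 f (a : bitree N) : R := downsum le (fun x => f (x, a.2)) a.1.
Definition down2 f (a : bitree N) : R := downsum le (fun y => f (a.1, y)) a.2.

Lemma up1_ge0 f a : (forall b, 0 <= f b) -> 0 <= up1 f a.
Proof. by move=> f0; apply: upsum_ge0. Qed.

Lemma up2_ge0 f a : (forall b, 0 <= f b) -> 0 <= up2 f a.
Proof. by move=> f0; apply: upsum_ge0. Qed.

Lemma up12 f a : up1 (up2 f) a = up2 (up1 f) a.
Proof. by rewrite /up1 /up2 /upsum /= exchange_big. Qed.

Lemma down1_up2 f a : down1 (up2 f) a = up2 (down1 f) a.
Proof. by rewrite /down1 /up2 /upsum /downsum /= exchange_big. Qed.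

Lemma sum_bitree f : \sum_a f a = \sum_x \sum_y f (x, y).
Proof. by rewrite pair_bigA; apply: eq_bigr => -[]. Qed.

Lemma up1_adjoint f g : \sum_a up1 f a * g a = \sum_a f a * down1 g a.
Proof.
rewrite !sum_bitree exchange_big [RHS]exchange_big; apply: eq_bigr => y _.
rewrite /up1 /down1 /upsum /downsum /=.
under eq_bigr do rewrite big_distrl.
under [RHS]eq_bigr do rewrite big_distrr.
by rewrite /= (exchange_big_dep xpredT).
Qed.

End Coordinates.

Section HardyCoordinates.
Context {R : realType} {N : nat}.
Implicit Types f mu : bitree N -> R.

Lemma hardy_up f a : hardy f a = up1 (up2 f) a.
Proof.
rewrite /up1 /up2 /upsum /= pair_big /hardy.
by apply: eq_big => -[x y].
Qed.

Lemma hardy_adj_down f a : hardy_adj f a = down1 (down2 f) a.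
Proof.
rewrite /down1 /down2 /downsum /= pair_big /hardy_adj.
by apply: eq_big => -[x y].
Qed.

Lemma ler_hardy f a b : (forall c, 0 <= f c) -> bitree_le a b ->
  hardy f b <= hardy f a.
Proof.
move=> f0; apply: ler_upsum => // x y z.
by case/andP=> ? ? /andP[? ?]; apply/andP; split; apply: dyadic_le_trans; eauto.
Qed.

Lemma hardy_mono f g a : (forall b, f b <= g b) -> hardy f a <= hardy g a.
Proof. by move=> fg; apply: ler_sum. Qed.

End HardyCoordinates.

(** * Pointwise estimates for the truncated potential *)

Section TruncatedEnergy.
Context {R : realType} {N : nat} (mu : bitree N -> R) (delta : R).
Hypothesis mu_ge0 : is_measure mu.
Hypothesis delta_gt0 : 0 < delta.

Definition truncated a : R := (a \in sublevel mu delta)%:R * hardy_adj mu a.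

Let f := truncated.
Let g := hardy_adj mu.
Let V := hardy f.

Lemma hardy_adj_ge0 a : 0 <= g a.
Proof. exact: sumr_ge0. Qed.

Lemma truncated_ge0 a : 0 <= f a.
Proof. by rewrite mulr_ge0 ?ler0n ?hardy_adj_ge0. Qed.

Lemma truncated_le a : f a <= g a.
Proof.
by rewrite /f /truncated; case: (_ \in _); rewrite ?mul1r ?mul0r ?hardy_adj_ge0.
Qed.

Lemma tpotential_ge0 a : 0 <= V a.
Proof. by apply: sumr_ge0 => b _; exact: truncated_ge0. Qed.

Lemma tpotential_le a : a \in sublevel mu delta -> V a <= delta.
Proof. by rewrite inE; apply: le_trans; apply: hardy_mono; exact: truncated_le. Qed.

Lemma tpotential_le_supp a : f a != 0 -> V a <= delta.
Proof.
move=> fa; apply: tpotential_le; move: fa; rewrite /f /truncated.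
by case: (_ \in _); rewrite // mul0r eqxx.
Qed.

Lemma truncatedM_le a : f a * V a <= delta * f a.
Proof.
case: (eqVneq (f a) 0) => [->|fa]; first by rewrite mul0r mulr0.
by rewrite mulrC ler_wpM2r ?truncated_ge0 ?tpotential_le_supp.
Qed.

Lemma tenergy_truncated : tenergy mu delta = \sum_a f a * g a.
Proof. exact: hardy_adjoint. Qed.

Lemma down1_mul_le (E : pred (bitree N)) w (t : R) a :
  (forall b, 0 <= w b) -> 0 <= t ->
  (forall b c, bitree_le b c -> E b -> E c) -> (forall b, E b -> up1 w b <= t) ->
  down1 (fun b => (E b)%:R * w b * g b) a <= t * ((E a)%:R * g a).
Proof.
move=> w0 t0 Eup Et; case: a => x y.
rewrite /g hardy_adj_down.
have := @downsum_mul_le R _ _ (@dyadic_le_refl N) (@dyadic_le_trans N)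
  (@dyadic_le_chain N) [pred x | E (x, y)] (fun x => w (x, y))
  (fun x => down2 mu (x, y)) t x.
rewrite /down1 /=.
under [X in _ -> X <= _]eq_bigr do rewrite hardy_adj_down.
apply=> // [z|z z' zz'|z Ez]; first exact: sumr_ge0.
  by apply: Eup; rewrite /bitree_le /= zz' dyadic_le_refl.
exact: Et (z, y) Ez.
Qed.

(** The sublevel set is closed upwards because the potential decreases upwards, and on it
    [up1 (up2 f) = V <= delta]. *)
Lemma down1_truncated_le a : down1 (fun b => f b * up2 f b) a <= delta * f a.
Proof.
have := @down1_mul_le [pred b | b \in sublevel mu delta] (up2 f) delta a.
rewrite /= -/(f a).
have -> : down1 (fun b => (b \in sublevel mu delta)%:R * up2 f b * g b) a =
    down1 (fun b => f b * up2 f b) a.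
  by apply: eq_bigr => x _; rewrite mulrAC.
apply=> // [b||b c bc|b].
- exact/up2_ge0/truncated_ge0.
- exact: ltW.
- rewrite !inE; apply: le_trans; apply: ler_hardy => // d; exact: hardy_adj_ge0.
- by move=> /tpotential_le; rewrite /V hardy_up.
Qed.

Let UV := fun a => up1 f a * up2 f a.

(* Pairs of points comparable in [bitree_le] contribute at most [2 * delta * V a]. *)
Lemma tpotential_sqr_le a : V a ^+ 2 <= 2 * delta * V a + 2 * hardy UV a.
Proof.
have inner b : up2 f b * up1 (up2 f) b <= delta * up2 f b + up2 UV b.
  rewrite up12.
  (* Splitting in the second variable: one term is [f * V <= delta * f], the other is [UV]. *)
  apply: le_trans (upsumM_le _ (@dyadic_le_trans N) (@dyadic_le_chain N) _ _ _ _ _) _.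
  - by move=> y; apply: truncated_ge0.
  - by move=> y; apply/up1_ge0/truncated_ge0.
  apply: lerD; last by [].
  rewrite /up2 /upsum mulr_sumr; apply: ler_sum => y _ /=.
  by apply: le_trans (truncatedM_le _); rewrite /V hardy_up up12.
rewrite {1 2}/V !hardy_up.
apply: le_trans (upsum_sqr_le _ (@dyadic_le_trans N) (@dyadic_le_chain N) _ _ _) _.
  by move=> x; apply/up2_ge0/truncated_ge0.
rewrite -mulrA -mulrDr ler_wpM2l // /up1 /upsum mulr_sumr -big_split /=.
by apply: ler_sum => x _; apply: inner.
Qed.

(** * Decay of the level sums *)

Let U := up1 (fun a => f a * up1 f a).
Let Z t := \sum_a (t < V a)%R%:R * (U a * up2 f a ^+ 2).

Let U_ge0 a : 0 <= U a.
Proof.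
apply: up1_ge0 => b; apply: mulr_ge0; first exact: truncated_ge0.
exact/up1_ge0/truncated_ge0.
Qed.

Lemma up2_sqr_le a : up2 f a ^+ 2 <= 2 * up2 (fun b => f b * up2 f b) a.
Proof.
apply: upsum_sqr_le; [exact: dyadic_le_trans|exact: dyadic_le_chain|].
by move=> y; apply: truncated_ge0.
Qed.

Lemma up1_sqr_le a : up1 f a ^+ 2 <= 2 * U a.
Proof.
apply: upsum_sqr_le; [exact: dyadic_le_trans|exact: dyadic_le_chain|].
by move=> y; apply: truncated_ge0.
Qed.

(** After [up2_sqr_le], [up1] moves to the other factor as [down1], which commutes with [up2] and
    meets [down1_truncated_le]. *)
Lemma sum_up1_up2_le h : (forall a, 0 <= h a) ->
  \sum_a up1 h a * up2 f a ^+ 2 <= 2 * delta * \sum_a h a * up2 f a.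
Proof.
move=> h0.
apply: (@le_trans _ _ (2 * \sum_a up1 h a * up2 (fun b => f b * up2 f b) a)).
  rewrite mulr_sumr; apply: ler_sum => a _; rewrite [leRHS]mulrCA ler_wpM2l ?up2_sqr_le //.
  exact: up1_ge0.
rewrite -mulrA ler_wpM2l // up1_adjoint mulr_sumr; apply: ler_sum => a _.
rewrite mulrCA ler_wpM2l // down1_up2 /up2 /upsum mulr_sumr.
by apply: ler_sum => y _; apply: down1_truncated_le.
Qed.

Lemma level_sum_step (t s : R) : delta <= t -> 0 <= s -> s * Z (t + s) <= 2 * delta * Z t.
Proof.
move=> dt s0.
have t0 : 0 <= t by rewrite (le_trans _ dt) // ltW.
(* With this [h], [upsum_level_le] for [w = up2 f] and [u = f * up1 f] bounds [s * U] by [up1 h]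
   where [V > t + s]; [u] lives where [V <= delta <= t]. *)
pose h a := (t < V a)%R%:R * (up2 f a * U a).
have h0 a : 0 <= h a.
  by rewrite !mulr_ge0 ?ler0n ?U_ge0 // up2_ge0 // => b; apply: truncated_ge0.
have hZ : Z t = \sum_a h a * up2 f a.
  by apply: eq_bigr => a _; rewrite /h expr2; ring.
rewrite hZ; apply: le_trans (sum_up1_up2_le _ h0).
rewrite mulr_sumr; apply: ler_sum => a _.
rewrite [leLHS](_ : _ = s * ((t + s < V a)%R%:R * U a) * up2 f a ^+ 2); last by ring.
rewrite ler_wpM2r ?sqr_ge0 //.
case: (ltP (t + s) (V a)) => tsV; last by rewrite mul0r mulr0 up1_ge0.
rewrite mul1r /U /up1.
have -> : upsum (@dyadic_le N) (fun x => h (x, a.2)) a.1 =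
  upsum (@dyadic_le N) (fun x =>
   (t < upsum (@dyadic_le N) (fun x => up2 f (x, a.2)) x)%R%:R *
   (up2 f (x, a.2) * upsum (@dyadic_le N) (fun x => f (x, a.2) * up1 f (x, a.2)) x)) a.1.
  by apply: eq_bigr => x _; rewrite /h /V hardy_up.
apply: upsum_level_le => //.
- exact: dyadic_le_refl.
- exact: dyadic_le_trans.
- exact: dyadic_le_chain.
- by move=> y; rewrite mulr_ge0 ?up1_ge0 //; move=> *; apply: truncated_ge0.
- by move=> y; rewrite up2_ge0 //; move=> *; apply: truncated_ge0.
- move=> y; rewrite mulf_eq0 negb_or => /andP[/tpotential_le_supp + _].
  by rewrite /V hardy_up => /le_trans; apply.
- by rewrite /V hardy_up in tsV.
Qed.

Lemma level_sum_le (t : R) : Z t <= 2 * delta ^+ 2 * tenergy mu delta.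
Proof.
apply: (@le_trans _ _ (\sum_a U a * up2 f a ^+ 2)).
  apply: ler_sum => a _; have := mulr_ge0 (U_ge0 a) (sqr_ge0 (up2 f a)).
  by case: (t < V a)%R; rewrite ?mul1r ?mul0r.
have fu a : 0 <= f a * up1 f a.
  by rewrite mulr_ge0 ?truncated_ge0 // up1_ge0 // => b; apply: truncated_ge0.
apply: le_trans (sum_up1_up2_le _ fu) _.
rewrite expr2 -!mulrA ler_wpM2l // ler_wpM2l ?(ltW delta_gt0) //.
have -> : \sum_a f a * up1 f a * up2 f a = \sum_a up1 f a * (f a * up2 f a).
  by apply: eq_bigr => a _; rewrite -mulrA mulrCA.
rewrite up1_adjoint tenergy_truncated mulr_sumr; apply: ler_sum => a _.
apply: (@le_trans _ _ (f a * (delta * f a))).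
  by rewrite ler_wpM2l ?truncated_ge0 // down1_truncated_le.
rewrite mulrCA ler_wpM2l ?(ltW delta_gt0) // ler_wpM2l ?truncated_ge0 ?truncated_le //.
Qed.

Lemma level_sum_decay (r : R) n : 0 < r ->
  Z (delta + n%:R * (r * delta)) <=
  (2 / r) ^+ n * (2 * delta ^+ 2 * tenergy mu delta).
Proof.
move=> r0; elim: n => [|n IH]; first by rewrite mul1r; apply: level_sum_le.
have rd : 0 < r * delta by rewrite mulr_gt0.
rewrite -natr1 mulrDl mul1r addrA.
have /level_sum_step : delta <= delta + n%:R * (r * delta).
  by rewrite lerDl mulr_ge0 // ltW.
move=> /(_ _ (ltW rd)); rewrite -ler_pdivlMl // => /le_trans; apply.
rewrite exprS -[leRHS]mulrA.
have -> : (r * delta)^-1 * (2 * delta * Z (delta + n%:R * (r * delta))) =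
   2 / r * Z (delta + n%:R * (r * delta)).
  by field; rewrite !gt_eqF.
by rewrite ler_wpM2l // divr_ge0 // ltW.
Qed.

(** * Testing against [mu] and absorption *)

Lemma sum_sublevel_le (t : R) : 0 <= t ->
  \sum_a (V a <= t)%R%:R * (UV a * g a) <= t * tenergy mu delta.
Proof.
move=> t0.
have -> : \sum_a (V a <= t)%R%:R * (UV a * g a) =
   \sum_a up1 f a * ((V a <= t)%R%:R * up2 f a * g a).
  by apply: eq_bigr => a _; rewrite /UV; ring.
rewrite up1_adjoint tenergy_truncated mulr_sumr; apply: ler_sum => a _.
rewrite mulrCA ler_wpM2l ?truncated_ge0 //.
apply: le_trans (down1_mul_le [pred b | V b <= t] (up2 f) t a _ t0 _ _) _ => /=.
- by move=> b; apply/up2_ge0/truncated_ge0.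
- by move=> b c bc; apply: le_trans; apply: ler_hardy => // d; apply: truncated_ge0.
- by move=> b; rewrite /V hardy_up.
rewrite ler_wpM2l //; case: (V a <= t)%R; rewrite ?mul1r // mul0r.
exact: hardy_adj_ge0.
Qed.

Lemma tenergy_le (r : R) n : 0 < r ->
  tenergy mu delta <=
  32 * (1 + n%:R * r) * delta * mass mu + 4 * (2 / r) ^+ n * energy mu.
Proof.
move=> r0; set q := (2 / r) ^+ n; set k := 1 + n%:R * r.
have q0 : 0 < q by rewrite exprn_gt0 // divr_gt0.
have k1 : 1 <= k by rewrite lerDl mulr_ge0 // ltW.
have k0 : 0 < k by apply: lt_le_trans k1.
set t := delta + n%:R * (r * delta).
have tE : t = k * delta by rewrite /t /k; ring.
have t0 : 0 < t by rewrite tE mulr_gt0.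
have dt : delta <= t by rewrite tE ler_peMl // ltW.
have UV0 a : 0 <= UV a.
  by rewrite mulr_ge0 ?up1_ge0 ?up2_ge0 //; move=> *; apply: truncated_ge0.
(* If [V > 8 * t], then [2 * delta * V <= V ^+ 2 / 4] is absorbed in the bound for [V ^+ 2]. *)
have VUV a : V a <= 8 * t + (2 * t)^-1 * hardy UV a.
  have H0 : 0 <= hardy UV a by apply: sumr_ge0.
  case: (leP (V a) (8 * t)) => Vt.
    by apply: (le_trans Vt); rewrite lerDl mulr_ge0 // invr_ge0 mulr_ge0 // ltW.
  have V0 : 0 <= V a := tpotential_ge0 a.
  have sq := tpotential_sqr_le a.
  suff : V a <= (2 * t)^-1 * hardy UV a.
    by move=> /le_trans; apply; rewrite lerDr mulr_ge0 // ltW.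
  rewrite ler_pdivlMl ?mulr_gt0 //.
  have : 8 * t * V a <= V a ^+ 2 by rewrite expr2 ler_wpM2r // ltW.
  have : delta * V a <= t * V a by rewrite ler_wpM2r.
  nra.
have tot : tenergy mu delta <= 8 * t * mass mu + (2 * t)^-1 * \sum_a UV a * g a.
  rewrite -hardy_adjoint /tenergy /mass !mulr_sumr -big_split /=.
  apply: ler_sum => a _; rewrite mulrA -mulrDl ler_wpM2r //; exact: VUV.
(* Chosen so that the decay of [Z] gives [2 * c * Z t] at most a quarter of the truncated energy;
   the dual weight in [amgm] is then [q * (delta / t) ^+ 2 <= q]. *)
pose c := (16 * q * delta ^+ 2)^-1.
have c0 : 0 < c by rewrite invr_gt0 !mulr_gt0 // exprn_gt0.
have high a : (2 * t)^-1 * (UV a * g a) <= c * UV a ^+ 2 + q * g a ^+ 2.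
  have amgm :
      (2 * t)^-1 * (UV a * g a) <= c * UV a ^+ 2 + (16 * c * t ^+ 2)^-1 * g a ^+ 2.
    have := sqr_ge0 (4 * c * t * UV a - g a).
    have : 0 < 16 * c * t ^+ 2 by rewrite !mulr_gt0 // exprn_gt0.
    move=> ct0 sq; rewrite -subr_ge0.
    have -> : c * UV a ^+ 2 + (16 * c * t ^+ 2)^-1 * g a ^+ 2 - (2 * t)^-1 * (UV a * g a) =
      (4 * c * t * UV a - g a) ^+ 2 / (16 * c * t ^+ 2).
      by field; rewrite !gt_eqF.
    by rewrite divr_ge0 // ltW.
  apply: (le_trans amgm); rewrite lerD2l ler_wpM2r ?sqr_ge0 // /c.
  rewrite (_ : (_)^-1 = q * (delta / t) ^+ 2); last by field; rewrite !gt_eqF.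
  rewrite ler_piMr ?(ltW q0) // expr_le1 ?divr_ge0 ?(ltW delta_gt0) ?(ltW t0) //.
  by rewrite ler_pdivrMr // mul1r.
have split_sum : (2 * t)^-1 * \sum_a UV a * g a <=
    (2 * t)^-1 * (t * tenergy mu delta) + c * (2 * Z t) + q * energy mu.
  apply: (@le_trans _ _ ((2 * t)^-1 * (\sum_a (V a <= t)%R%:R * (UV a * g a)) +
     \sum_a (t < V a)%R%:R * (c * UV a ^+ 2 + q * g a ^+ 2))).
    rewrite !mulr_sumr -big_split /=; apply: ler_sum => a _.
    case: (leP (V a) t) => _; rewrite !mul1r !mul0r ?mulr0 ?addr0 ?add0r //.
  rewrite -addrA lerD ?ler_wpM2l ?invr_ge0 ?mulr_ge0 ?(ltW t0) ?sum_sublevel_le ?(ltW t0) //.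
  rewrite energyE !mulr_sumr -big_split /=; apply: ler_sum => a _.
  have gg : 0 <= q * g a ^+ 2 by rewrite mulr_ge0 ?sqr_ge0 // ltW.
  case: (t < V a)%R; rewrite ?mul0r ?mul1r ?mulr0 ?add0r //.
  rewrite lerD2r ler_wpM2l ?(ltW c0) // /UV exprMn mulrA ler_wpM2r ?sqr_ge0 //.
  exact: up1_sqr_le.
have Zt := level_sum_decay r n r0; rewrite -/t -/q in Zt.
have cZ : c * (2 * Z t) <= 4^-1 * tenergy mu delta.
  rewrite (_ : 4^-1 * _ = c * (2 * (q * (2 * delta ^+ 2 * tenergy mu delta)))); last first.
    by rewrite /c; field; rewrite !gt_eqF.
  by rewrite !ler_wpM2l // ltW.
have half : (2 * t)^-1 * (t * tenergy mu delta) = 2^-1 * tenergy mu delta.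
  by field; rewrite gt_eqF.
(* One half plus one quarter of the truncated energy is absorbed on the left; multiplying by 4 gives
   the constants 32 and 4. *)
rewrite half in split_sum; rewrite -(mulrA 32) -tE.
lra.
Qed.

End TruncatedEnergy.

(** * Choice of the parameters *)

Lemma tenergy_le_energy {R : realType} {N : nat} (mu : bitree N -> R) (delta : R) :
  tenergy mu delta <= energy mu.
Proof.
rewrite tenergyE energyE big_mkcond; apply: ler_sum => a _.
by case: ifP => // _; apply: sqr_ge0.
Qed.

(** The condition for [1 < tau] excludes [delta] tending to infinity with [mu] fixed: there the
    truncated energy equals the energy while the right side tends to 0. *)
Theorem theorem2p2 (R : realType) (tau : R) (tau_gt0 : 0 < tau) :
  exists C : R,
    forall (N : nat) (mu : bitree N -> R) (delta : R),
      is_measure mu ->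
      0 < mass mu ->
      mass mu <= energy mu ->
      0 < delta ->
      (1 < tau -> delta * mass mu <= energy mu) ->
      tenergy mu delta
        <= C * delta `^ (1 - tau) * mass mu `^ (1 - tau) * energy mu `^ tau.
Proof.
(* This makes [1 / (n + 1) < tau]. *)
set n := Num.truncn (tau^-1).
exists (36 + 64 * n%:R) => N mu delta mu0 m0 mE d0 dE.
have E0 : 0 < energy mu := lt_le_trans m0 mE.
have D0 : 0 < delta * mass mu by rewrite mulr_gt0.
pose A := energy mu / (delta * mass mu).
have A0 : 0 < A by rewrite divr_gt0.
have EA : energy mu = delta * mass mu * A by rewrite /A; field; rewrite !gt_eqF.
have -> : (36 + 64 * n%:R) * delta `^ (1 - tau) * mass mu `^ (1 - tau) * energy mu `^ tau
    = delta * mass mu * ((36 + 64 * n%:R) * A `^ tau).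
  have Dpow : delta `^ (1 - tau) * mass mu `^ (1 - tau) = (delta * mass mu) `^ (1 - tau).
    by rewrite powRM // ltW.
  rewrite -[_ * _ * mass mu `^ _]mulrA Dpow EA (powRM _ (ltW D0) (ltW A0)) mulrA.
  rewrite -[_ * _ * (delta * mass mu) `^ tau]mulrA -powRD ?(gt_eqF D0) ?implybT //.
  by rewrite subrK powRr1 ?(ltW D0) // mulrAC mulrC mulrA.
have n1 : 1 <= 36 + 64 * n%:R :> R by have := ler0n R n; lra.
case: (ltP A 1) => A1.
  have tau1 : tau <= 1.
    rewrite leNgt; apply/negP => /dE; by rewrite EA ler_pMr // leNgt A1.
  apply: (le_trans (tenergy_le_energy _ _)); rewrite EA ler_wpM2l ?(ltW D0) //.
  apply: (@le_trans _ _ (A `^ tau)); last by rewrite ler_peMl ?powR_ge0.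
  by rewrite ger1_powR // A0 ltW.
pose s := A `^ (n.+1%:R^-1).
have s0 : 0 < s by rewrite powR_gt0.
have sA : s ^+ n.+1 = A.
  by rewrite -powR_mulrn ?(ltW s0) // -powRrM mulVf ?powRr1 ?(ltW A0) // pnatr_eq0.
have sle : s <= A `^ tau.
  rewrite ler_powR // invf_ple ?posrE // ?ltr0n //.
  by rewrite ltW // truncnS_gt.
have s1 : 1 <= s by rewrite -(powRr0 A) ler_powR.
(* With [r = 2 * s] and [A = s ^+ n.+1], both terms are [delta * mass mu] times at most a multiple
   of [s]: 32 + 64n and 4, whence the constant. *)
apply: le_trans (tenergy_le mu delta mu0 d0 (2 * s) n _) _; first by rewrite mulr_gt0.
have -> : 4 * (2 / (2 * s)) ^+ n * energy mu = delta * mass mu * (4 * s).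
  rewrite EA -sA exprS.
  have -> : 2 / (2 * s) = s^-1 by field; rewrite gt_eqF.
  rewrite exprVn; field; rewrite expf_neq0 //; by rewrite gt_eqF.
rewrite (_ : _ + _ = delta * mass mu * (32 * (1 + n%:R * (2 * s)) + 4 * s)); last by ring.
rewrite ler_wpM2l ?(ltW D0) //.
apply: (@le_trans _ _ ((36 + 64 * n%:R) * s)); first by nra.
by rewrite ler_wpM2l // (le_trans _ n1).
Qed.
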